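(* Let $M=\Gamma(G,u)$ be an MV-algebra, let $(m,\tau)$ be a dynamical system on $M$, and let $\mathcal{A}$ be a partition of unity in $M$. Then the limit $$\lim_{n\to\infty}\frac1n H_n(\mathcal{A},\tau)$$ exists.
   Context: Every MV-algebra is identified (Mundici's theorem) with $M=\Gamma(G,u)=\{h\in G:0\le h\le u\}$, where $G$ is a lattice-ordered Abelian group with strong unit $u$ (for every $g\in G$ there is an integer $n\ge1$ with $nu\ge g$), with operations $\neg g=u-g$, $g\oplus h=u\wedge(g+h)$, $g\odot h=0\vee(g+h-u)$. The symbols $+$ and $\sum$ denote addition in $G$. A partition of unity in $M$ is a finite tuple $\mathcal{A}=(a_1,\dots,a_k)$ of elements of $M$ with $a_1+\dots+a_k=u$. A common refinement of two partitions of unity $(a_1,\dots,a_k)$, $(b_1,\dots,b_l)$ is a matrix $(c_{ij})_{1\le i\le k,\,1\le j\le l}$ of elements of $M$ with $a_i=\sum_j c_{ij}$ for all $i$ and $b_j=\sum_i c_{ij}$ for all $j$; it is itself a partition of unity. Likewise, a common refinement of $n$ partitions of unity $\mathcal{A}^{(1)},\dots,\mathcal{A}^{(n)}$, with $\mathcal{A}^{(s)}=(a^{(s)}_1,\dots,a^{(s)}_{k_s})$, is an array $(c_{i_1\dots i_n})$ of elements of $M$ such that for every $s$ and every $i$ the sum of all $c_{i_1\dots i_n}$ with $i_s=i$ equals $a^{(s)}_i$ (for $n=1$ it is the partition itself). A dynamical system on $M$ is a pair of mappings $m:M\to[0,1]$, $\tau:M\to M$ such that: (i) if $a,b,c\in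 M$ and $a=b+c$, then $m(a)=m(b)+m(c)$ and $\tau(a)=\tau(b)+\tau(c)$; (ii) $\tau(u)=u$, $m(u)=1$; (iii) $m(\tau(a))=m(a)$ for all $a\in M$. The entropy of a partition of unity with (multi-)indexed family of elements $\mathcal{C}=(c_\iota)_\iota$ is $H(\mathcal{C})=\sum_\iota\varphi(m(c_\iota))$, where $\varphi(x)=-x\log x$ for $x>0$ and $\varphi(0)=0$. For a partition of unity $\mathcal{A}=(a_1,\dots,a_k)$, $\tau(\mathcal{A})=(\tau(a_1),\dots,\tau(a_k))$, which is again a partition of unity, and $\tau^i(\mathcal{A})$ is the $i$-fold iterate. For a positive integer $n$, $$H_n(\mathcal{A},\tau)=\inf\{H(\mathcal{C}):\mathcal{C}\text{ is a common refinement of }\mathcal{A},\tau(\mathcal{A}),\dots,\tau^{n-1}(\mathcal{A})\}.$$ *)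

(* Defs.v *)
From HB Require Import structures.
From mathcomp Require Import all_boot all_order all_algebra.
From mathcomp Require Import all_classical all_reals all_analysis.
Set Implicit Arguments.
Unset Strict Implicit.
Unset Printing Implicit Defensive.
Import Order.TTheory GRing.Theory Num.Theory.
Import numFieldNormedType.Exports.
Local Open Scope classical_set_scope.
Local Open Scope ring_scope.

(* Lattice-ordered Abelian groups.  The lattice operations sit directly on
   [porderZmodType], because HB does not accept a new join of [Order.Lattice]
   and [GRing.Zmodule] below the existing [Num.RealDomain]. *)
HB.mixin Record POrderedZmodule_isLGroup G & Num.POrderedZmodule G := {
  lgroup_lerD2l : forall z x y : G, x <= y -> z + x <= z + y;
  lgroup_meet : G -> G -> G;
  lgroup_join : G -> G -> G;
  lgroup_lexI : forall x y z : G,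
    (x <= lgroup_meet y z) = (x <= y) && (x <= z);
  lgroup_leUx : forall x y z : G,
    (lgroup_join x y <= z) = (x <= z) && (y <= z)
}.

#[short(type="lgroupType")]
HB.structure Definition LGroup :=
  { G of Num.POrderedZmodule G & POrderedZmodule_isLGroup G }.

Definition strong_unit (G : lgroupType) (u : G) : Prop :=
  forall g : G, exists2 n : nat, (0 < n)%N & g <= u *+ n.

Section StrongUnitNonneg.
Variable G : lgroupType.
Implicit Types x y z : G.

Let lerD2l z x y : x <= y -> z + x <= z + y.
Proof. exact: lgroup_lerD2l. Qed.

Let lerD x y z t : x <= y -> z <= t -> x + z <= y + t.
Proof.
move=> xy zt; apply: (le_trans (lerD2l x zt)).
by rewrite addrC [y + t]addrC; apply: lerD2l.
Qed.

Let lerBl x y z : z - x <= y -> z <= x + y.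
Proof. by move=> /(lerD2l x); rewrite addrC subrK. Qed.

Let lerBr x y z : z <= x + y -> z - x <= y.
Proof. by move=> /(lerD2l (- x)); rewrite addKr addrC. Qed.

Let lerDl x y : 0 <= y -> x <= x + y.
Proof. by move=> y0; have := lerD2l x y0; rewrite addr0. Qed.

Let leIl x y : lgroup_meet x y <= x.
Proof. by have := lexx (lgroup_meet x y); rewrite lgroup_lexI => /andP[]. Qed.

Let leIr x y : lgroup_meet x y <= y.
Proof. by have := lexx (lgroup_meet x y); rewrite lgroup_lexI => /andP[]. Qed.

Let leUl x y : x <= lgroup_join x y.
Proof. by have := lexx (lgroup_join x y); rewrite lgroup_leUx => /andP[]. Qed.

Let leUr x y : y <= lgroup_join x y.
Proof. by have := lexx (lgroup_join x y); rewrite lgroup_leUx => /andP[]. Qed.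

Let meet_addr x y z : 0 <= x -> 0 <= y -> 0 <= z ->
  lgroup_meet (x + y) z <= lgroup_meet x z + lgroup_meet y z.
Proof.
move=> x0 y0 z0; set w := lgroup_meet (x + y) z.
have wxy : w <= x + y by exact: leIl.
have wz : w <= z by exact: leIr.
apply: lerBl; rewrite lgroup_lexI; apply/andP; split.
- apply: lerBr; rewrite addrC; apply: lerBl; rewrite lgroup_lexI.
  apply/andP; split; apply: lerBr; first by rewrite addrC.
  by apply: le_trans wz _; rewrite addrC; apply: lerDl.
- apply: lerBr; apply: le_trans wz _; rewrite addrC; apply: lerDl.
  by rewrite lgroup_lexI x0 z0.
Qed.

Lemma strong_unit_ge0 (u : G) : strong_unit u -> 0 <= u.
Proof.
move=> hu.
pose p := lgroup_join u 0; pose q := p - u.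
have p0 : 0 <= p by exact: leUr.
have uE : u = p - q by rewrite /q opprB addrC subrK.
have q0 : 0 <= q.
  by have := lerD2l (- u) (leUl u 0 : u <= p); rewrite addNr addrC.
have pq0 : lgroup_meet p q <= 0.
  set w := lgroup_meet p q.
  have wp : w <= p by exact: leIl.
  have wq : w <= q by exact: leIr.
  have : p <= p - w.
    rewrite {1}/p lgroup_leUx; apply/andP; split.
      apply: le_trans (_ : p - q <= _); first by rewrite -uE.
      apply: lerD2l; have := lerD2l (- w - q) wq.
      by rewrite subrK addrAC addNr add0r.
    by have := lerD2l (- w) wp; rewrite addNr addrC.
  by move=> /(lerD2l (w - p)); rewrite subrK -[p - w]opprB subrr.
have npq0 n : lgroup_meet (p *+ n) q <= 0.
  elim: n => [|n IH]; first by rewrite mulr0n; exact: leIl.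
  have pn0 : 0 <= p *+ n.
    elim: n {IH} => [|n IH]; first by rewrite mulr0n.
    by rewrite mulrS; apply: le_trans IH _; rewrite addrC; apply: lerDl.
  rewrite mulrS; apply: le_trans (meet_addr p0 pn0 q0) _.
  by rewrite -[leRHS]addr0; apply: lerD.
have [n _ hn] := hu q.
have qn0 : 0 <= q *+ n.
  elim: n {hn} => [|n IH]; first by rewrite mulr0n.
  by rewrite mulrS; apply: le_trans IH _; rewrite addrC; apply: lerDl.
have qp : q <= p *+ n.
  apply: le_trans hn _.
  have -> : p *+ n = u *+ n + q *+ n by rewrite -mulrnDl uE subrK.
  exact: lerDl.
have q_le0 : q <= 0 by apply: le_trans (npq0 n); rewrite lgroup_lexI qp lexx.
have qE : q = 0 by apply/eqP; rewrite eq_le q_le0 q0.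
by rewrite uE qE subr0.
Qed.

End StrongUnitNonneg.

(* Carrier of the MV-algebra Gamma(G, u). *)
Definition Gamma (G : lgroupType) (u : G) : Type := {h : G | 0 <= h <= u}.

Lemma Gamma_top_subproof (G : lgroupType) (u : G) :
  strong_unit u -> 0 <= u <= u.
Proof. by move=> /strong_unit_ge0 ->; rewrite lexx. Qed.

Definition Gamma_top (G : lgroupType) (u : G) (hu : strong_unit u) : Gamma u :=
  exist _ u (Gamma_top_subproof hu).

Section Entropy.
Variables (R : realType) (G : lgroupType) (u : G).
Implicit Types (m : Gamma u -> R) (tau : Gamma u -> Gamma u).

Definition partition_of_unity (k : nat) (A : 'I_k -> Gamma u) : Prop :=
  \sum_(i < k) val (A i) = u.

(* An array (c_{i_1...i_n}) is a function of the multi-index t, whose s-th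
   coordinate t s ranges over 'I_(k s). *)
Definition common_refinement (n : nat) (k : 'I_n -> nat)
    (A : forall s : 'I_n, 'I_(k s) -> Gamma u)
    (c : {dffun forall s : 'I_n, 'I_(k s)} -> Gamma u) : Prop :=
  forall (s : 'I_n) (i : 'I_(k s)),
    val (A s i) =
      \sum_(t : {dffun forall s : 'I_n, 'I_(k s)} | t s == i) val (c t).

Record dynamical_system (hu : strong_unit u) m tau : Prop := {
  ds_range : forall a, 0 <= m a <= 1;
  ds_additive : forall a b c : Gamma u, val a = val b + val c ->
    m a = m b + m c /\ val (tau a) = val (tau b) + val (tau c);
  ds_top : tau (Gamma_top hu) = Gamma_top hu /\ m (Gamma_top hu) = 1;
  ds_invariant : forall a, m (tau a) = m a
}.

Definition phi (x : R) : R := if 0 < x then - x * ln x else 0.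

Definition entropy m (I : finType) (c : I -> Gamma u) : R :=
  \sum_(i : I) phi (m (c i)).

Definition tau_partition tau (k : nat) (A : 'I_k -> Gamma u) : 'I_k -> Gamma u :=
  fun i => tau (A i).

(* For n > 0 and A a partition of unity of a dynamical system, the set below is
   nonempty (Riesz decomposition in G) and bounded below by 0, so that [inf]
   is the genuine infimum; the value at n = 0 is irrelevant. *)
Definition entropy_n m tau (k : nat) (A : 'I_k -> Gamma u) (n : nat) : R :=
  inf [set entropy m c | c in
    @common_refinement n (fun=> k) (fun s : 'I_n => iter s (@tau_partition tau k) A)].

End Entropy.

(* Main.v *)
Require Import Defs.
From mathcomp Require Import all_boot all_order all_algebra.
From mathcomp Require Import all_classical all_reals all_analysis.
From mathcomp Require Import ring lra.
Import Order.TTheory GRing.Theory Num.Theory.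
Import numFieldNormedType.Exports.
Local Open Scope classical_set_scope.
Local Open Scope ring_scope.

(** Write H n for the infimum of the entropies of the common refinements of A,
    tau A, ..., tau^(n-1) A.  The limit exists because H is nonnegative and
    subadditive, H (n + p) <= H n + H p, so that Fekete's lemma [fekete]
    applies.

    For the subadditivity, take a common refinement C of the first n iterates
    of A and a common refinement D of the first p iterates.  Since tau preserves
    sums and u, tau^n D is a partition of unity which refines
    tau^n A, ..., tau^(n+p-1) A, and since m is invariant it has the entropy
    of D.  An Abelian l-group has the Riesz refinement property
    ([riesz_refinement]), so C and tau^n D have a common refinement E, and E
    refines all of the first n + p iterates ([common_refinement_cat]).

    Nothing is known about E besides its row and column sums, but this is
    enough: the numbers m (E x y) form a probability distribution on a product
    whose marginals are the distributions m C and m (tau^n D), and the entropy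
    of any joint distribution is at most the sum of the entropies of its
    marginals ([joint_entropy_le]).  Thus H (n + p) <= H(C) + H(D), and it
    remains to take the infimum over C and over D. *)

(** * Riesz refinement in Abelian l-groups *)

Lemma lgroup_subr_ge0 {G : lgroupType} (x y : G) : (0 <= y - x) = (x <= y).
Proof.
apply/idP/idP => [/(lgroup_lerD2l x)|/(lgroup_lerD2l (- x))].
  by rewrite addr0 addrC subrK.
by rewrite addNr addrC.
Qed.

Lemma lgroup_lerBC {G : lgroupType} (x y z : G) : (x - y <= z) = (x - z <= y).
Proof. by rewrite -lgroup_subr_ge0 -[RHS]lgroup_subr_ge0 !opprB addrCA. Qed.

Lemma lgroup_lerDl {G : lgroupType} (x y : G) : 0 <= y -> x <= x + y.
Proof. by move/(lgroup_lerD2l x); rewrite addr0. Qed.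

Lemma lgroup_addr_ge0 {G : lgroupType} (x y : G) :
  0 <= x -> 0 <= y -> 0 <= x + y.
Proof. by move=> x0 /(lgroup_lerDl x); apply: le_trans. Qed.

Lemma lgroup_sumr_ge0 {G : lgroupType} {I : Type} (r : seq I) (P : pred I)
    (F : I -> G) :
  (forall i, P i -> 0 <= F i) -> 0 <= \sum_(i <- r | P i) F i.
Proof. by move=> F0; elim/big_ind: _ => // x y; apply: lgroup_addr_ge0. Qed.

(** An element below a sum b_1 + ... + b_l is peeled off greedily: x meet b_1
    is given to b_1, and the rest x - (x meet b_1) = (x - b_1) join 0 still
    lies below b_2 + ... + b_l, so that one can go on with it. *)
Lemma riesz_decomposition {G : lgroupType} {J : eqType} (s : seq J)
    (b : J -> G) (x : G) :
  uniq s -> (forall j, 0 <= b j) -> 0 <= x -> x <= \sum_(j <- s) b j ->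
  exists y : J -> G,
    (forall j, 0 <= y j <= b j) /\ x = \sum_(j <- s) y j.
Proof.
move=> + b0; elim: s x => [|j0 s IHs] x.
  move=> _ x0; rewrite big_nil => xle0; exists (fun=> 0); split.
    by move=> j; rewrite lexx b0.
  by rewrite big_nil; apply/eqP; rewrite eq_le xle0 x0.
move=> /= /andP[j0s us] x0; rewrite big_cons => xle.
pose x0' := lgroup_meet x (b j0).
have [x0x x0b] : x0' <= x /\ x0' <= b j0.
  by apply/andP; rewrite -lgroup_lexI.
have x0'0 : 0 <= x0' by rewrite lgroup_lexI x0 b0.
have rest0 : 0 <= \sum_(j <- s) b j by exact: lgroup_sumr_ge0.
have le_rest : x - x0' <= \sum_(j <- s) b j.
  rewrite lgroup_lerBC lgroup_lexI lgroup_lerBC subrr rest0 lgroup_lerBC.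
  by rewrite -lgroup_subr_ge0 opprB addrCA addrA lgroup_subr_ge0.
have [|y [yb yE]] := IHs _ us _ le_rest; first by rewrite lgroup_subr_ge0.
exists (fun j => if j == j0 then x0' else y j); split=> [j|].
  by case: eqP => [->|_]; [rewrite x0'0 x0b | exact: yb].
rewrite big_cons eqxx -[LHS](subrK x0') addrC yE; congr (_ + _).
apply: eq_big_seq => j js; case: eqP => // jj0.
by rewrite -jj0 js in j0s.
Qed.

(** The matrix is built row by row: the first row is the decomposition of a_1
    along the b_j, and the other rows refine the remaining a_i against the
    remainders b_j - y_j. *)
Lemma riesz_refinement {G : lgroupType} {I J : finType} (a : I -> G)
    (b : J -> G) :
  (forall i, 0 <= a i) -> (forall j, 0 <= b j) ->
  \sum_i a i = \sum_j b j ->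
  exists c : I -> J -> G,
    [/\ forall i j, 0 <= c i j, forall i, a i = \sum_j c i j
      & forall j, b j = \sum_i c i j].
Proof.
move=> a0 b0 ab.
(* The remainders change the column sums at every step, so that the induction
   on the list of rows quantifies over b. *)
suff: forall s : seq I, uniq s -> forall b : J -> G, (forall j, 0 <= b j) ->
    \sum_(i <- s) a i = \sum_j b j ->
    exists c : I -> J -> G,
    [/\ forall i j, 0 <= c i j, forall i, i \in s -> a i = \sum_j c i j
      & forall j, b j = \sum_(i <- s) c i j].
  move=> /(_ _ (index_enum_uniq I) b b0 ab)[c [c0 ca cb]]; exists c; split=> //.
  by move=> i; apply: ca; rewrite mem_index_enum.
elim=> [|i0 s IHs] /=.
  move=> _ {b0 ab}b b0; rewrite big_nil => b_sum0.
  exists (fun _ _ => 0); split=> // j; rewrite big_nil.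
  apply/eqP; rewrite eq_le b0 andbT b_sum0 (bigD1 j) //=.
  by apply/lgroup_lerDl/lgroup_sumr_ge0.
move=> /andP[i0s us] {b0 ab}b b0; rewrite big_cons => ab.
have a_le : a i0 <= \sum_j b j.
  by rewrite -ab; apply/lgroup_lerDl/lgroup_sumr_ge0.
have [y [yb yE]] := riesz_decomposition _ _ _ (index_enum_uniq J) b0 (a0 i0) a_le.
have [j||c [c0 ca cb]] := IHs us (fun j => b j - y j).
- by rewrite lgroup_subr_ge0; have /andP[] := yb j.
- by rewrite sumrB -ab -yE addrC addKr.
exists (fun i j => if i == i0 then y j else c i j); split=> [i j|i|j].
- by case: eqP => // _; have /andP[] := yb j.
- rewrite in_cons; case: eqP => [->|_] //=; exact: ca.
rewrite big_cons eqxx -[LHS](subrK (y j)) addrC cb; congr (_ + _).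
apply: eq_big_seq => i js; case: eqP => // ii0.
by rewrite -ii0 js in i0s.
Qed.

(** * Partitions and refinements in Gamma(G, u) *)

(** Additivity on two summands extends to finite sums because a partial sum of
    a family with sum a lies between 0 and a, hence again in Gamma(G, u).  The
    empty sum needs f 0 = 0, which follows from 0 = 0 + 0. *)
Lemma Gamma_additive_sum {G : lgroupType} {u : G} {V : zmodType} (f : Gamma u -> V)
    {I : Type} (r : seq I) (P : pred I) (b : I -> Gamma u) (a : Gamma u) :
  (forall a b c : Gamma u, val a = val b + val c -> f a = f b + f c) ->
  val a = \sum_(i <- r | P i) val (b i) -> f a = \sum_(i <- r | P i) f (b i).
Proof.
move=> fD; elim: r a => [|i r IHr] a.
  rewrite !big_nil => a0; have /eqP : f a = f a + f a by apply: fD; rewrite a0 addr0.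
  by rewrite -subr_eq0 opprD addNKr oppr_eq0 => /eqP.
rewrite !big_cons; case: ifP => _; last exact: IHr.
move=> aE; set S := \sum_(j <- r | P j) _ in aE.
have SG : 0 <= S <= u.
  have S0 : 0 <= S by apply: lgroup_sumr_ge0 => j _; have /andP[] := valP (b j).
  have /andP[bi0 _] := valP (b i); have /andP[_ au] := valP a.
  rewrite S0; apply: le_trans au; rewrite aE addrC; exact: lgroup_lerDl.
by rewrite (fD a (b i) (exist _ S SG) aE) (IHr (exist _ S SG) erefl).
Qed.

Lemma Gamma_refinement {G : lgroupType} {u : G} {I J : finType}
    (c : I -> Gamma u) (d : J -> Gamma u) :
  \sum_i val (c i) = \sum_j val (d j) ->
  exists e : I -> J -> Gamma u,
    (forall i, val (c i) = \sum_j val (e i j)) /\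
    (forall j, val (d j) = \sum_i val (e i j)).
Proof.
have ge0 (a : Gamma u) : 0 <= val a by have /andP[] := valP a.
move=> /(riesz_refinement _ _ (fun i => ge0 (c i)) (fun j => ge0 (d j))).
move=> [e [e0 ce de]].
have eu i j : 0 <= e i j <= u.
  have /andP[_ cu] := valP (c i); rewrite e0; apply: le_trans cu.
  rewrite ce (bigD1 j) //=.
  by apply/lgroup_lerDl/lgroup_sumr_ge0.
by exists (fun i j => exist _ (e i j) (eu i j)).
Qed.

Notation multi_index n k := {dffun forall s : 'I_n, 'I_k}.

Definition index_cat {n p k} (x : multi_index n k) (y : multi_index p k) :
    multi_index (n + p) k :=
  [ffun s : 'I_(n + p) =>
     (match fintype.split s with inl i => x i | inr j => y j end : 'I_k)].

Definition index_left {n p k} (t : multi_index (n + p) k) : multi_index n k :=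
  [ffun s : 'I_n => (t (lshift p s) : 'I_k)].

Definition index_right {n p k} (t : multi_index (n + p) k) : multi_index p k :=
  [ffun s : 'I_p => (t (rshift n s) : 'I_k)].

Lemma index_left_cat {n p k} (x : multi_index n k) (y : multi_index p k) :
  index_left (index_cat x y) = x.
Proof.
by apply/ffunP => s; rewrite !ffunE -[lshift p s]/(unsplit (inl s)) unsplitK.
Qed.

Lemma index_right_cat {n p k} (x : multi_index n k) (y : multi_index p k) :
  index_right (index_cat x y) = y.
Proof.
by apply/ffunP => s; rewrite !ffunE -[rshift n s]/(unsplit (inr s)) unsplitK.
Qed.

Lemma index_cat_split {n p k} (t : multi_index (n + p) k) :
  index_cat (index_left t) (index_right t) = t.
Proof. by apply/ffunP => s; rewrite ffunE; case: split_ordP => j ->; rewrite ffunE. Qed.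

(** Concatenation is a bijection between pairs of multi-indices and
    multi-indices of length n + p; a double sum over a pair of refinements is
    thus a sum over the entries of their common refinement. *)
Lemma big_index_cat {V : nmodType} {n p k} (P : pred (multi_index n k))
    (Q : pred (multi_index p k)) (F : multi_index n k -> multi_index p k -> V) :
  \sum_(t : multi_index (n + p) k | P (index_left t) && Q (index_right t))
      F (index_left t) (index_right t) =
  \sum_(x | P x) \sum_(y | Q y) F x y.
Proof.
rewrite pair_big (reindex (fun xy => index_cat xy.1 xy.2)) /=.
  by apply: eq_big => [xy|xy _]; rewrite index_left_cat index_right_cat.
exists (fun t => (index_left t, index_right t)) => [[x y] _|t _] /=.
  by rewrite index_left_cat index_right_cat.
exact: index_cat_split.
Qed.

(** Fixing one coordinate of the concatenated index and summing the other block
    away first leaves an entry of c or of d, whose own refinement property then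
    applies. *)
Lemma common_refinement_cat {G : lgroupType} {u : G} {n p k : nat}
    (A : 'I_(n + p) -> 'I_k -> Gamma u)
    (c : multi_index n k -> Gamma u) (d : multi_index p k -> Gamma u)
    (e : multi_index n k -> multi_index p k -> Gamma u) :
  @common_refinement G u n (fun=> k) (fun s => A (lshift p s)) c ->
  @common_refinement G u p (fun=> k) (fun s => A (rshift n s)) d ->
  (forall x, val (c x) = \sum_y val (e x y)) ->
  (forall y, val (d y) = \sum_x val (e x y)) ->
  @common_refinement G u (n + p) (fun=> k) A
    (fun t => e (index_left t) (index_right t)).
Proof.
move=> cA dA ce de s i; case: (split_ordP s) => j ->.
  rewrite cA (eq_bigr _ (fun x _ => ce x)).
  rewrite -(@big_index_cat _ n p k (fun x => x j == i) predT (fun x y => val (e x y))).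
  by apply: eq_bigl => t; rewrite ffunE andbT.
rewrite dA (eq_bigr _ (fun y _ => de y)) exchange_big /=.
rewrite -(@big_index_cat _ n p k predT (fun y => y j == i) (fun x y => val (e x y))).
by apply: eq_bigl => t; rewrite ffunE.
Qed.

(** * Entropy of a joint distribution *)

Lemma phi_ge0 {R : realType} (x : R) : x <= 1 -> 0 <= phi x.
Proof.
move=> x1; rewrite /phi; case: ifP => // x0.
by rewrite mulNr oppr_ge0 mulr_ge0_le0 ?ln_le0 // ltW.
Qed.

(** This is the inequality ln y <= y - 1 at y = p q / x, multiplied by x.  The
    bounds x <= p and x <= q make p and q positive when x is, so that the
    logarithm of y splits. *)
Lemma phi_le_gibbs {R : realType} (x p q : R) : 0 <= x -> x <= p -> x <= q ->
  phi x <= - (x * ln p) - x * ln q + p * q - x.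
Proof.
move=> x0 xp xq; rewrite /phi; case: ltP => [x_gt0|xle0].
  have p0 := lt_le_trans x_gt0 xp; have q0 := lt_le_trans x_gt0 xq.
  have y0 : 0 < p * q / x by rewrite divr_gt0 // mulr_gt0.
  have : ln (p * q / x) <= p * q / x - 1.
    have := @le_ln1Dx R (p * q / x - 1); rewrite addrCA subrr addr0; apply.
    by lra.
  rewrite ln_div ?lnM ?posrE ?mulr_gt0 // => /(ler_wpM2l x0).
  rewrite !mulrBr mulrDr mulr1 mulrCA mulfV ?gt_eqF // mulr1; lra.
have -> : x = 0 by apply/eqP; rewrite eq_le xle0.
by rewrite !mul0r !oppr0 !add0r addr0 mulr_ge0 // (le_trans x0).
Qed.

Lemma phiE {R : realType} (x : R) : 0 <= x -> phi x = - (x * ln x).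
Proof.
by rewrite /phi le_eqVlt mulNr => /predU1P[<-|->//]; rewrite ltxx mul0r oppr0.
Qed.

(** Summed over i and j, the bound of [phi_le_gibbs] becomes the sum of the two
    marginal entropies, because its last two terms, the product distribution
    and x itself, both have total mass 1 and cancel. *)
Lemma joint_entropy_le {R : realType} {I J : finType} (p : I -> R) (q : J -> R)
    (x : I -> J -> R) :
  (forall i j, 0 <= x i j) ->
  (forall i, p i = \sum_j x i j) -> (forall j, q j = \sum_i x i j) ->
  \sum_i p i = 1 ->
  \sum_i \sum_j phi (x i j) <= \sum_i phi (p i) + \sum_j phi (q j).
Proof.
move=> x0 px qx p1.
have q1 : \sum_j q j = 1.
  rewrite -p1 (eq_bigr _ (fun j _ => qx j)) exchange_big /=.
  by apply: eq_bigr => i _; rewrite px.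
have xp i j : x i j <= p i by rewrite px (bigD1 j) //= lerDl sumr_ge0.
have xq i j : x i j <= q j by rewrite qx (bigD1 i) //= lerDl sumr_ge0.
have le_gibbs : \sum_i \sum_j phi (x i j) <=
    \sum_i \sum_j (- (x i j * ln (p i)) - x i j * ln (q j) + p i * q j - x i j).
  by do 2!apply: ler_sum => ? _; apply: phi_le_gibbs.
apply: le_trans le_gibbs _.
under eq_bigr do rewrite !big_split /= !sumrN -mulr_suml -mulr_sumr -px q1 mulr1.
rewrite !big_split /= [X in _ + X + _ + _]sumrN exchange_big /=.
under [X in _ - X + _ + _]eq_bigr do rewrite -mulr_suml -qx.
rewrite [X in _ + X <= _]sumrN addrK -sumrN.
by apply: lerD; apply: ler_sum => ? _; rewrite phiE // ?px ?qx sumr_ge0.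
Qed.


(** * Fekete's lemma *)

(** Fix p >= 1 with a_p / p close to the infimum and divide: for n = q p + r,
    subadditivity gives a_n <= q a_p + a_r, hence a_n / n <= a_p / p + K / n
    with a constant K that depends on p only. *)
Lemma fekete {R : realType} (a : nat -> R) (c : R) :
  (forall n p, a (n + p)%N <= a n + a p) -> (forall n, c * n%:R <= a n) ->
  (fun n => n%:R^-1 * a n) @ \oo -->
    inf [set n%:R^-1 * a n | n in [set n | (0 < n)%N]].
Proof.
move=> aD a_ge; set S := [set _ | _ in _].
have S_lb : lbound S c.
  move=> _ [n /= n0 <-]; rewrite mulrC ler_pdivlMr ?ltr0n //; exact: a_ge.
have S_inf : has_inf S by split; [exists (1%:R^-1 * a 1%N); exists 1%N|exists c].
apply/cvgrPdist_le => e e0.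
have e2 : 0 < e / 2 by rewrite divr_gt0.
have [_ [p /= p0 <-] ap] := inf_adherent e2 S_inf.
(* The first part of K bounds a_r; the second one pays for replacing q a_p by
   n a_p / p, an error of (r / p) |a_p| when a_p is negative. *)
pose K := \sum_(r < p) `|a r| + `|a p|.
have aq q r : a (q * p + r)%N <= q%:R * a p + a r.
  elim: q => [|q IHq]; first by rewrite mul0n add0n mul0r add0r.
  rewrite mulSn -addnA; apply: le_trans (aD _ _) _.
  by rewrite mulrS mulrDl mul1r -addrA lerD2l.
have a_le n : a n <= n%:R * (p%:R^-1 * a p) + K.
  have pr0 : p%:R != 0 :> R by rewrite pnatr_eq0 -lt0n.
  rewrite {1 2}(divn_eq n p); have rp : (n %% p < p)%N by rewrite ltn_mod.
  apply: le_trans (aq _ _) _; rewrite natrD natrM.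
  have -> : ((n %/ p)%N%:R * p%:R + (n %% p)%N%:R) * (p%:R^-1 * a p) =
            (n %/ p)%N%:R * a p + (n %% p)%N%:R / p%:R * a p by field.
  rewrite -addrA lerD2l.
  have ar : a (n %% p)%N <= \sum_(r < p) `|a r|.
    apply: le_trans (ler_norm _) _.
    by rewrite (bigD1 (Ordinal rp)) //= lerDl sumr_ge0.
  have : - `|a p| <= (n %% p)%N%:R / p%:R * a p.
    apply: lerNnormlW; rewrite normrM ler_piMl // ger0_norm ?divr_ge0 //.
    by rewrite ler_pdivrMr ?ltr0n // mul1r ler_nat ltnW.
  by rewrite /K; lra.
near=> n.
have n0 : (0 < n)%N by near: n; exact: nbhs_infty_gt.
have nR0 : 0 < n%:R :> R by rewrite ltr0n.
have inf_le : inf S <= n%:R^-1 * a n by apply: ge_inf; [exists c|exists n].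
rewrite distrC ger0_norm ?subr_ge0 //.
have Kn : K / (e / 2) <= n%:R by near: n; exact: nbhs_infty_ger.
have KnE : n%:R^-1 * K <= e / 2.
  by rewrite mulrC ler_pdivrMr // mulrC -ler_pdivrMr.
have : n%:R^-1 * a n <= p%:R^-1 * a p + n%:R^-1 * K.
  have := ler_wpM2l (ltW (_ : 0 < n%:R^-1)) (a_le n).
  by rewrite invr_gt0 mulrDr mulKf ?gt_eqF //; apply.
by lra.
Unshelve. all: by end_near.
Qed.

(** * Subadditivity of the entropy along an orbit *)

Section DynamicalSystem.
Context {R : realType} {G : lgroupType} {u : G} {hu : strong_unit u}.
Context {m : Gamma u -> R} {tau : Gamma u -> Gamma u}.
Hypothesis hdyn : dynamical_system hu m tau.

(** Having the iterates as dynamical systems gives their additivity,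
    normalisation and invariance at once. *)
Lemma dynamical_system_iter n : dynamical_system hu m (iter n tau).
Proof.
case: hdyn => mr add [tau1 m1] minv; split=> //.
- move=> a b c abc; split; first by have [] := add _ _ _ abc.
  by elim: n => //= n IHn; have [] := add _ _ _ IHn.
- by split=> //; elim: n => //= n ->.
- by move=> a; elim: n => //= n IHn; rewrite minv.
Qed.

Lemma measure_sum {I : finType} (P : pred I) (b : I -> Gamma u) (a : Gamma u) :
  val a = \sum_(i | P i) val (b i) -> m a = \sum_(i | P i) m (b i).
Proof. by apply: Gamma_additive_sum => x y z /(ds_additive hdyn)[]. Qed.

Lemma iter_sum n {I : finType} (P : pred I) (b : I -> Gamma u) (a : Gamma u) :
  val a = \sum_(i | P i) val (b i) ->
  val (iter n tau a) = \sum_(i | P i) val (iter n tau (b i)).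
Proof.
apply: (Gamma_additive_sum (fun x => val (iter n tau x))) => x y z.
by move=> /(ds_additive (dynamical_system_iter n))[].
Qed.

Lemma entropy_ge0 {I : finType} (c : I -> Gamma u) : 0 <= entropy m c.
Proof.
by apply: sumr_ge0 => i _; apply: phi_ge0; have /andP[] := ds_range hdyn (c i).
Qed.

Lemma entropy_iter n {I : finType} (c : I -> Gamma u) :
  entropy m (fun i => iter n tau (c i)) = entropy m c.
Proof.
by apply: eq_bigr => i _; rewrite (ds_invariant (dynamical_system_iter n)).
Qed.

Context {k : nat} {A : 'I_k -> Gamma u}.
Hypothesis hA : partition_of_unity A.

Definition orbit_refinement {n : nat} (c : multi_index n k -> Gamma u) : Prop :=
  @common_refinement G u n (fun=> k)
    (fun s => iter s (@tau_partition G u tau k) A) c.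

Lemma iter_tau_partition n i :
  iter n (@tau_partition G u tau k) A i = iter n tau (A i).
Proof. by elim: n => //= n <-. Qed.

(** The entries are grouped by their first coordinate, which gives back A.  A
    coordinate is needed for this: with n = 0 every one-element family is
    vacuously a refinement. *)
Lemma orbit_refinement_sum {n} {c : multi_index n k -> Gamma u} :
  (0 < n)%N -> orbit_refinement c -> \sum_t val (c t) = u.
Proof.
case: n c => // n c _ /(_ ord0) cA.
apply: etrans hA; rewrite (partition_big (fun t : multi_index n.+1 k => t ord0) predT) //=.
by apply: eq_bigr => i _; rewrite -cA.
Qed.

Lemma orbit_refinement_shift n {p} {d : multi_index p k -> Gamma u} :
  orbit_refinement d ->
  @common_refinement G u p (fun=> k)
    (fun s => iter (n + s) (@tau_partition G u tau k) A)
    (fun t => iter n tau (d t)).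
Proof.
move=> dA s i; rewrite iter_tau_partition iterD; apply: iter_sum.
by rewrite -dA iter_tau_partition.
Qed.

(** The step which carries the subadditivity: c and the shift of d by tau^n are
    refined jointly, and the entropy of the result is bounded by that of its
    marginals. *)
Lemma orbit_refinement_join {n p} {c : multi_index n k -> Gamma u}
    {d : multi_index p k -> Gamma u} :
  (0 < n)%N -> (0 < p)%N -> orbit_refinement c -> orbit_refinement d ->
  exists2 e : multi_index (n + p) k -> Gamma u,
    orbit_refinement e & entropy m e <= entropy m c + entropy m d.
Proof.
move=> n0 p0 cA dA; pose d' t := iter n tau (d t).
have cu := orbit_refinement_sum n0 cA.
have d'u : \sum_t val (d' t) = u.
  have /(iter_sum n) <- : val (Gamma_top hu) = \sum_t val (d t).
    exact/esym/orbit_refinement_sum.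
  by have [-> _] := ds_top (dynamical_system_iter n).
have [e [ce de]] := Gamma_refinement c d' (etrans cu (esym d'u)).
exists (fun t => e (index_left t) (index_right t)).
  exact: common_refinement_cat cA (orbit_refinement_shift n dA) ce de.
rewrite -(entropy_iter n d) /entropy.
rewrite (big_index_cat predT predT (fun x y => phi (m (e x y)))).
apply: joint_entropy_le => [x y|x|y|].
- by have /andP[] := ds_range hdyn (e x y).
- exact: measure_sum.
- exact: (measure_sum _ _ _ (de y)).
have [_ <-] := ds_top hdyn; apply/esym/measure_sum; exact/esym.
Qed.

(** Joining A with itself repeatedly yields a refinement of every length, so
    that the infimum in [entropy_n] is taken over a nonempty set. *)
Lemma orbit_refinement_exists n :
  exists c : multi_index n k -> Gamma u, orbit_refinement c.
Proof.
case: n => [|n]; first by exists (fun=> Gamma_top hu) => -[].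
have c1 : orbit_refinement (fun t : multi_index 1 k => A (t ord0)).
  move=> s i; rewrite (ord1 s) /= (big_pred1 [ffun=> i]) ?ffunE // => t.
  apply/eqP/eqP => [<-|->]; last by rewrite ffunE.
  by apply/ffunP => j; rewrite ffunE (ord1 j).
elim: n => [|n [c cA]]; first by exists (fun t : multi_index 1 k => A (t ord0)).
by have [e eA _] := orbit_refinement_join (ltn0Sn 0) (ltn0Sn n) c1 cA; exists e.
Qed.

Lemma entropy_n_le {n} {c : multi_index n k -> Gamma u} :
  orbit_refinement c -> entropy_n m tau A n <= entropy m c.
Proof.
move=> cA; apply: ge_inf; last by exists c.
by exists 0 => _ [? _ <-]; exact: entropy_ge0.
Qed.

Lemma le_entropy_n n (x : R) :
  (forall c : multi_index n k -> Gamma u, orbit_refinement c ->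
     x <= entropy m c) ->
  x <= entropy_n m tau A n.
Proof.
move=> xle; apply: lb_le_inf => [|_ [c cA <-]]; last exact: xle.
by have [c cA] := orbit_refinement_exists n; exists (entropy m c); exists c.
Qed.

Lemma entropy_n_ge0 n : 0 <= entropy_n m tau A n.
Proof. by apply: le_entropy_n => c _; exact: entropy_ge0. Qed.

Lemma entropy_n_subadditive n p :
  entropy_n m tau A (n + p) <= entropy_n m tau A n + entropy_n m tau A p.
Proof.
(* Refinements can be joined only for positive lengths; at 0 the inequality
   follows from nonnegativity. *)
have [->|n0] := posnP n; first by rewrite add0n lerDr entropy_n_ge0.
have [->|p0] := posnP p; first by rewrite addn0 lerDl entropy_n_ge0.
rewrite -lerBlDr; apply: le_entropy_n => c cA; rewrite lerBlDr addrC -lerBlDr.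
apply: le_entropy_n => d dA; rewrite lerBlDr addrC.
have [e eA] := orbit_refinement_join n0 p0 cA dA.
exact: le_trans (entropy_n_le eA).
Qed.

End DynamicalSystem.

Theorem theorem1 (R : realType) (G : lgroupType) (u : G) (hu : strong_unit u)
  (m : Gamma u -> R) (tau : Gamma u -> Gamma u)
  (hdyn : dynamical_system hu m tau)
  (k : nat) (A : 'I_k -> Gamma u) (hA : partition_of_unity A) :
  exists l : R, (fun n : nat => n%:R^-1 * entropy_n m tau A n) @ \oo --> l.
Proof.
eexists; apply: (fekete _ 0) => [n p|n].
  exact: (entropy_n_subadditive hdyn hA n p).
by rewrite mul0r; exact: (entropy_n_ge0 hdyn hA n).
Qed.
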